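(* Let $a\ge b>c>0$ be rational, put $H=a+2b$, and consider the target pair $$H_w=(0,a,a+b,H),\qquad H_r=(0,c,2c,3c).$$ Then $H>3c$, and exactly one of the following four cases holds (caps $K$ range over integers $K\ge1$): (i) $3c<H<9c/2$. The pair does not satisfy $\mathrm{EC}^{v}_4$ (vertex-only capped EC at $K=4$) and is realizable at no integer cap and not uncapped. (ii) $9c/2\le H<6c$. The pair satisfies $\mathrm{EC}^{v}_4$, but is realizable at no integer cap and not uncapped. (iii) $6c\le H<9c$. The pair is realizable precisely at $K=4$ among all integer caps, and is not realizable uncapped. (iv) $H\ge9c$. The pair is realizable uncapped and at every integer cap $K\ge4$.
   Context: Instances and realizability. An instance consists of a finite set $E$ of items with rational values $a_i\ge 0$, positive integer sizes $d_i$, and integer capacities $0\le R<D$, with $d_i\le D$ for every item. Write $G(S)=\sum_{i\in S}a_i$ and $d(S)=\sum_{i\in S}d_i$. For $\alpha\in\{w,r\}$ let $U^\alpha(n)$ be the maximum of $G(S)$ over $n$-element admissible sets $S\subseteq E$, with value $-\infty$ if there is none; $U^\alpha(0)=0$. In the uncapped model $S$ is admissible if $d(S)\le D$ (for $\alpha=w$) or $d(S)\le R$ (for $\alpha=r$). At an integer cap $K\ge1$ one requires in addition $|S|\le K$ for $\alpha=w$ and $|S|\le K-1$ for $\alpha=r$. The terminal count is $b_\alpha=\min\operatorname{arg\,max}_n U^\alpha(n)$. The hull is the sequence on $\{0,\dots,b_\alpha\}$ obtained by evaluating at integers the upper concave hull of the points $(n,U^\alpha(n))$, $0\le n\le b_\alpha$.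 A target pair $(H_w,H_r)$ consists of strictly increasing concave rational sequences $H_\alpha$ on $\{0,\dots,b_\alpha\}$ with $H_\alpha(0)=0$. It is realizable uncapped (respectively at cap $K$) if a single instance has terminal counts $b_w,b_r$ and hulls exactly $H_w,H_r$ in that model. Notation. $\rho_1=H_r(1)$ ($0$ if $b_r=0$); $\bar H_\alpha(k)=H_\alpha(\min\{k,b_\alpha\})$. A positive count $n\le b_\alpha$ is an $\alpha$-vertex if $n=b_\alpha$ or the slopes of $H_\alpha$ immediately before and after $n$ differ. Dominance means $H_r(k)\le\bar H_w(k)$ for $0\le k\le b_r$. Vertex-only capped EC. A pair satisfies $\mathrm{EC}^{v}_K$ if $b_w\le K$, $b_r\le K-1$, dominance holds, and there is a witness consisting of: for each $w$-vertex $n$, an $n$-element labeled set $X_n$ with rational values $x_{n,i}$, a long/short label for each member, and a downward-closed family $\mathcal F_n$ of subsets of $X_n$ containing $\varnothing$ and whose singletons are precisely the short members; for each $r$-vertex $m$, an $m$-element set $Z_m$ with rational values $z_{m,j}$; for each such $(n,m)$, a subset $O_{n,m}\subseteq X_n$ with $O_{n,m}\in\mathcal F_n$ and a map $\pi_{n,m}:O_{n,m}\to Z_m$; such that: (EC1) $0\le x_{n,i}\le H_w(1)$, short values are at most $\rho_1$, $\sum_i x_{n,i}=H_w(n)$; every $S\subseteq X_n$ with $|S|\le K$ has total value at most $\bar H_w(|S|)$, and every $S\in\mathcal F_n$ with $|S|\le K-1$ has total value at most $\bar H_r(|S|)$. (EC2) $0\le z_{m,j}\le\rho_1$, $\sum_j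 z_{m,j}=H_r(m)$, and every $S\subseteq Z_m$ has total value at most $\bar H_r(|S|)$. (EC3) $\pi_{n,m}$ is injective, $O_{n,m}$ contains only short members, and $x_{n,i}=z_{m,\pi_{n,m}(i)}$ for $i\in O_{n,m}$. (EC4) For every $(n,m)$ with $n-1+m-k\le K$, where $k=|O_{n,m}|$, and every long $i\in X_n$, $\bar H_w(n-1+m-k)\ge H_w(n)-x_{n,i}+H_r(m)-\sum_{i'\in O_{n,m}}z_{m,\pi_{n,m}(i')}$. (EC5) For every $(n,m)$ with $m+1\le K$, every two-element subset $\{i,i'\}\subseteq X_n$ with $\{i,i'\}\notin\mathcal F_n$, and every $y\in X_n\setminus(\{i,i'\}\cup O_{n,m})$, $\bar H_w(m+1)\ge x_{n,y}+H_r(m)$. (That is: EC with bounds imposed only at cap-admissible counts and exchanges whose output count exceeds $K$ omitted.) *)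

(* Defs.v *)
(** MathComp, with the extended order [\bar rat] from mathcomp-reals. *)
From HB Require Import structures.
From mathcomp Require Import all_boot all_order all_algebra.
From mathcomp Require Import constructive_ereal.

Set Implicit Arguments.
Unset Strict Implicit.
Unset Printing Implicit Defensive.

Import Order.TTheory GRing.Theory Num.Theory.
Local Open Scope ring_scope.

Variant side := SideW | SideR.

Record instance := Instance {
  item : finType;
  value : item -> rat;
  isize : item -> nat;
  capR : nat;
  capD : nat;
  value_ge0 : forall i, 0 <= value i;
  isize_gt0 : forall i, (0 < isize i)%N;
  capR_lt_capD : (capR < capD)%N;
  isize_le_capD : forall i, (isize i <= capD)%N
}.

Section Instances.

Variable I : instance.

Definition total_value (S : {set item I}) : rat := \sum_(i in S) value i.
Definition total_size (S : {set item I}) : nat := (\sum_(i in S) isize i)%N.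

Definition capacity (al : side) : nat :=
  match al with SideW => capD I | SideR => capR I end.

(** [None] is the uncapped model, [Some K] the model at cap [K]. *)
Definition count_ok (cap : option nat) (al : side) (n : nat) : bool :=
  match cap, al with
  | None, _ => true
  | Some K, SideW => (n <= K)%N
  | Some K, SideR => (n < K)%N
  end.

Definition admissible (cap : option nat) (al : side) (S : {set item I}) : bool :=
  (total_size S <= capacity al)%N && count_ok cap al #|S|.

Definition U (cap : option nat) (al : side) (n : nat) : \bar rat :=
  \big[Order.max/-oo%E]_(S : {set item I} | admissible cap al S && (#|S| == n))
    (total_value S)%:E.

End Instances.

(** [b] is the smallest maximiser of [u]. *)
Definition is_terminal_count (u : nat -> \bar rat) (b : nat) : Prop :=
  (forall n, (u n <= u b)%E) /\ (forall n, (n < b)%N -> (u n < u b)%E).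

(** A sequence on {0, ..., b} is a list of length b + 1. *)
Definition last_count (H : seq rat) : nat := (size H).-1.
Definition ext (H : seq rat) (k : nat) : rat := H`_(minn k (last_count H)).

Definition is_weight (b k : nat) (l : 'I_b.+1 -> rat) : Prop :=
  [/\ forall n, 0 <= l n, \sum_n l n = 1 & \sum_n l n * n%:R = k%:R].

Definition combination (u : nat -> \bar rat) (b : nat) (l : 'I_b.+1 -> rat) :
  \bar rat := (\sum_(n < b.+1) (l n)%:E * u n)%E.

(** The hull at [k] is the largest ordinate of a point with abscissa [k] in the
    convex hull of the points (n, u n), n <= b. As [0 * -oo = 0], points at
    [-oo] contribute only combinations equal to [-oo]. The points and abscissae
    being rational, rational weights attain the maximum. *)
Definition is_hull (u : nat -> \bar rat) (b : nat) (H : seq rat) : Prop :=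
  size H = b.+1 /\
  forall k, (k <= b)%N ->
    (exists2 l, is_weight k l & combination u (b := b) l = (H`_k)%:E) /\
    (forall l, is_weight k l -> (combination u (b := b) l <= (H`_k)%:E)%E).

Definition is_target (H : seq rat) : Prop :=
  [/\ (0 < size H)%N, H`_0 = 0,
      forall k, (k < last_count H)%N -> H`_k < H`_k.+1 &
      forall k, (k.+1 < last_count H)%N ->
        H`_k.+2 - H`_k.+1 <= H`_k.+1 - H`_k].

Definition is_target_pair (Hw Hr : seq rat) : Prop :=
  is_target Hw /\ is_target Hr.

Definition realizable (cap : option nat) (Hw Hr : seq rat) : Prop :=
  exists I : instance, forall al : side,
    let H := match al with SideW => Hw | SideR => Hr end in
    is_terminal_count (U I cap al) (last_count H) /\
    is_hull (U I cap al) (last_count H) H.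

Definition realizable_uncapped (Hw Hr : seq rat) : Prop :=
  realizable None Hw Hr.

Definition realizable_at (K : nat) (Hw Hr : seq rat) : Prop :=
  realizable (Some K) Hw Hr.

Definition rho1 (Hr : seq rat) : rat :=
  if last_count Hr == 0%N then 0 else Hr`_1.

Definition is_vertex (H : seq rat) (n : nat) : Prop :=
  [/\ (0 < n)%N, (n <= last_count H)%N &
      n = last_count H \/ H`_n - H`_n.-1 != H`_n.+1 - H`_n].

Definition dominance (Hw Hr : seq rat) : Prop :=
  forall k, (k <= last_count Hr)%N -> Hr`_k <= ext Hw k.

(** The n-element sets X_n and Z_n are both indexed by ['I_n]. Only the
    components at vertices are constrained; elsewhere [ecO] may be empty, so
    that [ecpi] exists even into ['I_0]. *)
Record ec_witness := ECWitness {
  ecx : forall n, 'I_n -> rat;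
  ecshort : forall n, {set 'I_n};
  ecF : forall n, {set {set 'I_n}};
  ecz : forall m, 'I_m -> rat;
  ecO : forall n, nat -> {set 'I_n};
  ecpi : forall n m, {i : 'I_n | i \in ecO n m} -> 'I_m
}.

Section ExchangeConditions.

Variables (K : nat) (Hw Hr : seq rat) (W : ec_witness).

Definition ec_family : Prop := forall n, is_vertex Hw n ->
  [/\ set0 \in ecF W n,
      forall S T : {set 'I_n}, T \subset S -> S \in ecF W n -> T \in ecF W n &
      forall i : 'I_n, ([set i] \in ecF W n) = (i \in ecshort W n)].

Definition ec_link : Prop := forall n m, is_vertex Hw n -> is_vertex Hr m ->
  ecO W n m \in ecF W n.

Definition EC1 : Prop := forall n, is_vertex Hw n ->
  [/\ forall i : 'I_n, 0 <= ecx W i <= Hw`_1,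
      forall i : 'I_n, i \in ecshort W n -> ecx W i <= rho1 Hr,
      \sum_(i < n) ecx W i = Hw`_n,
      forall S : {set 'I_n}, (#|S| <= K)%N ->
        \sum_(i in S) ecx W i <= ext Hw #|S| &
      forall S : {set 'I_n}, S \in ecF W n -> (#|S| < K)%N ->
        \sum_(i in S) ecx W i <= ext Hr #|S|].

Definition EC2 : Prop := forall m, is_vertex Hr m ->
  [/\ forall j : 'I_m, 0 <= ecz W j <= rho1 Hr,
      \sum_(j < m) ecz W j = Hr`_m &
      forall S : {set 'I_m}, \sum_(j in S) ecz W j <= ext Hr #|S|].

Definition EC3 : Prop := forall n m, is_vertex Hw n -> is_vertex Hr m ->
  [/\ injective (@ecpi W n m),
      ecO W n m \subset ecshort W n &
      forall u : {i : 'I_n | i \in ecO W n m},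
        ecx W (val u) = ecz W (ecpi u)].

Definition EC4 : Prop := forall n m, is_vertex Hw n -> is_vertex Hr m ->
  let k := #|ecO W n m| in
  (n - 1 + m - k <= K)%N ->
  forall i : 'I_n, i \notin ecshort W n ->
    Hw`_n - ecx W i + Hr`_m
      - \sum_(u : {i : 'I_n | i \in ecO W n m}) ecz W (ecpi u)
    <= ext Hw (n - 1 + m - k).

Definition EC5 : Prop := forall n m, is_vertex Hw n -> is_vertex Hr m ->
  (m + 1 <= K)%N ->
  forall i i' : 'I_n, i != i' -> [set i; i'] \notin ecF W n ->
  forall y : 'I_n, y \notin [set i; i'] :|: ecO W n m ->
    ecx W y + Hr`_m <= ext Hw (m + 1).

End ExchangeConditions.

Definition ECv (K : nat) (Hw Hr : seq rat) : Prop :=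
  [/\ (last_count Hw <= K)%N, (last_count Hr < K)%N, dominance Hw Hr &
      exists W : ec_witness,
        ec_family Hw W /\ ec_link Hw Hr W /\
        [/\ EC1 K Hw Hr W, EC2 Hr W, EC3 Hw Hr W,
            EC4 K Hw Hr W & EC5 K Hw Hr W]].

Definition exactly_one (Ps : seq Prop) : Prop :=
  exists! i : 'I_(size Ps), nth False Ps i.

(* Main.v *)
Require Import Defs.
From mathcomp Require Import all_boot all_order all_algebra.
From mathcomp Require Import constructive_ereal ring lra zify.

Set Implicit Arguments.
Unset Strict Implicit.
Unset Printing Implicit Defensive.

Import Order.TTheory GRing.Theory Num.Theory.
Local Open Scope ring_scope.

(** Write [H = a + 2 * b].

    Necessity. In any realization the optimal [SideW]-triple [X] consists of
    items worth at least [b > c], because its pairs are worth at most [a + b],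
    whereas an item that fits into the smaller capacity is worth at most [c].
    So [X] is disjoint from the optimal [SideR]-triple [Z], whose items are worth
    [c] each, and each member of [X] takes more room than all of [Z]. Replacing
    one member of [X] by [t] items of [Z] gives a set of [t + 2] items that still
    fits, so that each member of [X] is worth at least [t * c] and
    [H >= 3 * t * c] ([realizable_exchange]). The triple [Z] needs [K >= 4]. At
    [K = 4] the exchange with [t = 2] is available and gives [H >= 6 * c]; at
    [K >= 5] and without a cap, so is [t = 3], which gives [H >= 9 * c].

    The exchange conditions only see the full triple [Z]. At [K = 4] the result
    of the exchange has too many items when one member of [X] is traded, but not
    when two are: keeping one member [y] of [X] along with [Z] gives
    [x_y + 3 * c <= H], which sums to [H >= 9 * c / 2] ([ECv_bound]). Three equal
    values [H / 3] attain this bound ([ECv_balanced]). The gap between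
    [9 * c / 2] and [6 * c] comes from trading one member of [X] for two of the
    three items of [Z], which neither (EC4) nor (EC5) expresses.

    Sufficiency. The same equal triple, three items of value [c] and a single
    item of value [a] that fills the knapsack alone form an instance in which the
    trades above are the binding ones ([balanced_realizes]). *)

(** * Hulls and terminal counts *)

Lemma combination_dirac (u : nat -> \bar rat) (b : nat) (k : 'I_b.+1)
    (l : 'I_b.+1 -> rat) :
  l k = 1 -> (forall n, n != k -> l n = 0) -> combination u l = u k.
Proof.
move=> lk l0; rewrite /combination (bigD1 k) //= lk mul1e big1 ?adde0 // => n nk.
by rewrite l0 // mul0e.
Qed.

(** The end of the range is an extreme point: no other weights have mean [b]. *)
Lemma weight_at_end (b : nat) (l : 'I_b.+1 -> rat) :
  is_weight b l -> l ord_max = 1 /\ forall n, n != ord_max -> l n = 0.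
Proof.
case=> l_ge0 l_sum l_mean.
(* The weighted distances to b are nonnegative and sum to zero. *)
have gap n : 0 <= (b - n)%:R :> rat by [].
have l0 n : n != ord_max -> l n = 0.
  move=> n_neq.
  have /psumr_eq0P: \sum_(n < b.+1) l n * (b - n)%:R = 0.
    under eq_bigr => i _ do rewrite natrB ?mulrBr -1?ltnS //.
    by rewrite sumrB -mulr_suml l_sum l_mean mul1r subrr.
  move=> /(_ (fun i _ => mulr_ge0 (l_ge0 i) (gap i)) n isT) /eqP.
  rewrite mulf_eq0 => /orP[/eqP //|].
  rewrite pnatr_eq0 subn_eq0 => b_le_n; case/eqP: n_neq.
  by apply/val_inj/eqP; rewrite eqn_leq b_le_n -ltnS ltn_ord.
by split=> //; move: l_sum; rewrite (bigD1 ord_max) //= big1 ?addr0.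
Qed.

Lemma hull_le (u : nat -> \bar rat) (b : nat) (H : seq rat) :
  is_hull u b H -> forall n, (n <= b)%N -> (u n <= (H`_n)%:E)%E.
Proof.
move=> [_ hullH] n n_le_b; have n_lt : (n < b.+1)%N by [].
pose l (i : 'I_b.+1) : rat := (i == Ordinal n_lt)%:R.
rewrite -[u n](@combination_dirac u b (Ordinal n_lt) l) /l ?eqxx //; last first.
  by move=> i /negPf->.
apply: (hullH n n_le_b).2; split.
- by move=> i; exact: ler0n.
- by rewrite (bigD1 (Ordinal n_lt)) //= eqxx big1 ?addr0 // => i /negPf->.
rewrite (bigD1 (Ordinal n_lt)) //= eqxx mul1r big1 ?addr0 // => i /negPf->.
by rewrite mul0r.
Qed.

Lemma hull_at_end (u : nat -> \bar rat) (b : nat) (H : seq rat) :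
  is_hull u b H -> u b = (H`_b)%:E.
Proof.
move=> [_ /(_ b (leqnn b))[[l /weight_at_end[l1 l0] <-] _]].
by rewrite (combination_dirac u l1 l0).
Qed.

Lemma terminal_hull_le (u : nat -> \bar rat) (H : seq rat) :
    is_terminal_count u (last_count H) -> is_hull u (last_count H) H ->
  forall n, (u n <= (ext H n)%:E)%E.
Proof.
move=> [u_max _] hullH n; rewrite /ext.
case: (leqP n (last_count H)) => n_le; first by apply: hull_le n_le.
by rewrite -(hull_at_end hullH) u_max.
Qed.

(** A supporting line at each abscissa bounds the hull from above; a chord
    between two attained points, containing the graph of [H] in between, bounds
    it from below. *)
Lemma hull_of_chords (u : nat -> \bar rat) (b : nat) (H : seq rat) :
    size H = b.+1 ->
    (forall n, (n <= b)%N -> (u n <= (H`_n)%:E)%E) ->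
    (forall k, (k <= b)%N ->
      exists s, forall n, (n <= b)%N -> H`_n <= H`_k + s * (n%:R - k%:R)) ->
    (forall k, (k <= b)%N -> exists i j,
      [/\ [&& i <= k, k <= j, i < j & j <= b]%N,
          u i = (H`_i)%:E, u j = (H`_j)%:E &
          (j%:R - i%:R) * H`_k = (j%:R - k%:R) * H`_i + (k%:R - i%:R) * H`_j]) ->
  is_hull u b H.
Proof.
move=> sizeH u_le support chord; split=> // k k_le_b; split; last first.
  move=> l [l_ge0 l_sum l_mean]; have [s line] := support k k_le_b.
  have -> : H`_k = \sum_(n < b.+1) l n * (H`_k + s * (n%:R - k%:R)).
    rewrite (eq_bigr (fun n => l n * (H`_k - s * k%:R) + l n * n%:R * s)).
      by rewrite big_split /= -!mulr_suml l_sum l_mean; lra.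
    by move=> n _; ring.
  rewrite /combination -sumEFin; apply: lee_sum => n _.
  rewrite EFinM; apply: lee_wpmul2l; first by rewrite lee_fin.
  by apply: le_trans (u_le n _) _; rewrite ?lee_fin ?line -1?ltnS.
have [i [j [/and4P[ik kj ij jb] ui uj on_chord]]] := chord k k_le_b.
have i_lt : (i < b.+1)%N by lia.
have j_lt : (j < b.+1)%N by lia.
pose i' := Ordinal i_lt; pose j' := Ordinal j_lt.
have ji' : j' != i' by apply/eqP => /(congr1 val) /= ?; lia.
have len_gt0 : 0 < j%:R - i%:R :> rat by rewrite subr_gt0 ltr_nat.
have len_neq0 : j%:R - i%:R != 0 :> rat by rewrite gt_eqF.
pose l (n : 'I_b.+1) : rat :=
  if n == i' then (j%:R - k%:R) / (j%:R - i%:R)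
  else if n == j' then (k%:R - i%:R) / (j%:R - i%:R) else 0.
have li : l i' = (j%:R - k%:R) / (j%:R - i%:R) by rewrite /l eqxx.
have lj : l j' = (k%:R - i%:R) / (j%:R - i%:R) by rewrite /l (negPf ji') eqxx.
have l0 n : (n != i') && (n != j') -> l n = 0.
  by rewrite /l => /andP[/negPf-> /negPf->].
exists l; last first.
  rewrite /combination (bigD1 i') //= (bigD1 j') //= big1 ?adde0; last first.
    by move=> n /l0->; rewrite mul0e.
  rewrite ui uj li lj -!EFinM -EFinD; congr EFin.
  apply: (mulfI len_neq0); rewrite on_chord; field.
  by rewrite len_neq0.
split.
- have ? : 0 <= j%:R - k%:R :> rat by rewrite subr_ge0 ler_nat.
  have ? : 0 <= k%:R - i%:R :> rat by rewrite subr_ge0 ler_nat.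
  by move=> n; rewrite /l; do 2?case: ifP => _ //; rewrite divr_ge0 // ltW.
- rewrite (bigD1 i') //= (bigD1 j') //= big1 ?addr0 ?li ?lj //.
  by field.
- rewrite (bigD1 i') //= (bigD1 j') //= big1 ?addr0 ?li ?lj => [|n /l0->].
    by field.
  by rewrite mul0r.
Qed.

Lemma terminal_count_of_increasing (u : nat -> \bar rat) (H : seq rat) :
    (forall n, (u n <= (ext H n)%:E)%E) ->
    u (last_count H) = (H`_(last_count H))%:E ->
    (forall n, (n < last_count H)%N -> H`_n < H`_(last_count H)) ->
  is_terminal_count u (last_count H).
Proof.
move=> u_le u_end H_lt; split=> n.
  apply: le_trans (u_le n) _; rewrite u_end lee_fin /ext.
  by case: ltnP => [/H_lt/ltW|].
move=> n_lt; apply: le_lt_trans (u_le n) _.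
by rewrite u_end lte_fin /ext (minn_idPl (ltnW n_lt)) H_lt.
Qed.

(** * Optimal admissible sets *)

Lemma le_U (I : instance) cap al (S : {set item I}) :
  admissible cap al S -> ((total_value S)%:E <= U I cap al #|S|)%E.
Proof. by move=> admS; apply: le_bigmax_cond; rewrite admS eqxx. Qed.

Lemma U_le (I : instance) cap al n (x : rat) :
    (forall S : {set item I}, admissible cap al S -> #|S| = n ->
      total_value S <= x) ->
  (U I cap al n <= x%:E)%E.
Proof.
move=> le_x; apply: bigmax_le => [|S /andP[admS /eqP cardS]]; first exact: leNye.
by rewrite lee_fin le_x.
Qed.

Lemma U_attained (I : instance) cap al n (x : rat) :
    U I cap al n = x%:E ->
  exists S : {set item I},
    [/\ admissible cap al S, #|S| = n & x <= total_value S].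
Proof.
move=> Ux.
case: (boolP [exists S : {set item I},
  [&& admissible cap al S, #|S| == n & x <= total_value S]]).
  by move=> /existsP[S /and3P[? /eqP ? ?]]; exists S.
rewrite negb_exists => /forallP no_set.
suff : (U I cap al n < x%:E)%E by rewrite Ux ltxx.
apply: bigmax_lt => [|S /andP[admS cardS]]; first exact: ltNyr.
by have := no_set S; rewrite admS cardS /= -ltNge lte_fin.
Qed.

Lemma U_of_attained (I : instance) cap al (H : seq rat) (S : {set item I}) :
    (forall T : {set item I}, admissible cap al T -> total_value T <= ext H #|T|) ->
    (#|S| <= last_count H)%N -> admissible cap al S -> H`_#|S| <= total_value S ->
  U I cap al #|S| = (H`_#|S|)%:E.
Proof.
move=> value_le card_le admS valS; apply/eqP; rewrite eq_le; apply/andP; split.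
  apply: U_le => T admT cardT.
  by have := value_le T admT; rewrite cardT /ext (minn_idPl card_le).
by apply: le_trans (le_U admS); rewrite lee_fin.
Qed.

Lemma admissible_subset (I : instance) cap al (S T : {set item I}) :
  T \subset S -> admissible cap al S -> admissible cap al T.
Proof.
move=> TS /andP[sizeS countS].
have sizeT : (total_size T <= total_size S)%N.
  by rewrite /total_size [in leqRHS](big_setID T) /= (setIidPr TS) leq_addr.
have cardT := subset_leq_card TS.
rewrite /admissible (leq_trans sizeT sizeS) /=.
by case: cap al countS {sizeS} => [K|] [] //=; lia.
Qed.

(** * Consequences of realizability *)

Definition target_w (a b : rat) : seq rat := [:: 0; a; a + b; a + 2 * b].
Definition target_r (c : rat) : seq rat := [:: 0; c; 2 * c; 3 * c].

Lemma ext_target_w_le (a b : rat) n : 0 < b -> b <= a ->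
  ext (target_w a b) n <= a + 2 * b.
Proof. by move=> b0 ba; case: n => [|[|[|[|n]]]]; rewrite /ext /=; lra. Qed.

Lemma ext_target_r (c : rat) n : (n <= 3)%N -> ext (target_r c) n = n%:R * c.
Proof. by case: n => [|[|[|[|n]]]] // _; rewrite /ext /=; lra. Qed.

(** All that a realization imposes and that the exchange argument uses: the
    hull bounds every admissible value, and the terminal value is attained. *)
Lemma realizable_bounds cap (Hw Hr : seq rat) :
    realizable cap Hw Hr ->
  exists I : instance, forall al,
    let H := match al with SideW => Hw | SideR => Hr end in
    (forall S : {set item I}, admissible cap al S -> total_value S <= ext H #|S|)
    /\ exists S : {set item I}, [/\ admissible cap al S,
         #|S| = last_count H & H`_(last_count H) <= total_value S].
Proof.
move=> [I realI]; exists I => al; have [termH hullH] := realI al; split.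
  move=> S /le_U U_ge; rewrite -lee_fin; apply: le_trans U_ge _.
  exact: terminal_hull_le.
exact/U_attained/hull_at_end.
Qed.

(** An optimal [SideW]-set [X] is a triple whose pairs are worth at most [a + b],
    so its members are worth at least [b > c]; no such item fits into [capR].
    Let [Z] be an optimal [SideR]-triple. Trading a member of [X] for [t] members
    of [Z] therefore lowers the total size. If the resulting count is allowed,
    the total value cannot grow, so the member is worth at least [t * c]. *)
Lemma realizable_exchange cap (t : nat) (a b c : rat) :
    0 < c -> c < b -> b <= a ->
    realizable cap (target_w a b) (target_r c) ->
    (t <= 3)%N -> count_ok cap SideW (2 + t) ->
  3 * (t%:R * c) <= a + 2 * b.
Proof.
move=> c_gt0 cb ba /realizable_bounds[I boundI] t_le3 count_t.
have [w_le [X [admX cardX valX]]] := boundI SideW.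
have [r_le [Z [admZ cardZ valZ]]] := boundI SideR.
rewrite /= in w_le r_le valX valZ; rewrite /last_count /= in cardX cardZ.
have total_rem (A B : {set item I}) : B \subset A ->
  total_value A = total_value B + total_value (A :\: B).
  by move=> BA; rewrite /total_value (big_setID B) /= (setIidPr BA).
have singleton (i : item I) : total_value [set i] = value i.
  by rewrite /total_value big_set1.
have card_rem i : i \in X -> #|X :\ i| = 2.
  by move=> iX; move: (cardsD1 i X); rewrite iX cardX => -[].
have X_large i : i \in X -> b <= value i.
  move=> iX; have := w_le _ (admissible_subset (subD1set X i) admX).
  rewrite card_rem // /ext /= => pair_le.
  have := total_rem X [set i]; rewrite sub1set iX singleton => /(_ isT).
  by move: pair_le valX; lra.
have small_r (i : item I) : (isize i <= capR I)%N -> value i <= c.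
  move=> i_fits; rewrite -singleton.
  have := r_le [set i]; rewrite cards1 ext_target_r // mul1r; apply.
  rewrite /admissible cards1 /total_size big_set1 i_fits /=.
  move: admZ => /andP[_]; rewrite cardZ.
  by case: cap {boundI w_le r_le admX count_t} => //= K; lia.
have X_long i : i \in X -> (capR I < isize i)%N.
  move=> iX; rewrite ltnNge; apply/negP => /small_r.
  by have := X_large i iX; lra.
have [T TZ cardT] : exists2 T : {set item I}, T \subset Z & #|T| = t.
  have : (0 < #|[set A : {set item I} | A \subset Z & #|A| == t]|)%N.
    by rewrite cards_draws bin_gt0 cardZ.
  by case/card_gt0P => T; rewrite inE => /andP[TZ /eqP ?]; exists T.
(* The other members of Z are worth at most c each, and Z is worth 3 * c. *)
have valT : t%:R * c <= total_value T.
  have := total_rem Z T TZ.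
  have := r_le _ (admissible_subset (subsetDl Z T) admZ).
  rewrite cardsD (setIidPr TZ) cardZ cardT ext_target_r ?leq_subr //.
  by rewrite natrB //; move: valZ; lra.
have sizeT : (total_size T <= capR I)%N.
  by have /andP[] := admissible_subset TZ admZ.
have item_ge i : i \in X -> t%:R * c <= value i.
  move=> iX.
  (* A common member would be both longer than capR and part of a set that
     fits into capR. *)
  have disj : [disjoint X :\ i & T].
    rewrite disjoint_subset; apply/subsetP => j /setD1P[_ jX]; rewrite inE.
    apply/negP => jT; have := X_long j jX; rewrite ltnNge => /negP; apply.
    apply: leq_trans sizeT; rewrite /total_size (bigD1 j) //=; exact: leq_addr.
  have in_swap j : (j \in X :\ i :|: T) = (j \in [predU X :\ i & T]).
    by rewrite in_setU.
  have card_swap : #|(X :\ i) :|: T| = (2 + t)%N.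
    by rewrite cardsU (disjoint_setI0 disj) cards0 subn0 card_rem // cardT.
  have adm_swap : admissible cap SideW ((X :\ i) :|: T).
    rewrite /admissible card_swap count_t andbT /total_size.
    rewrite (eq_bigl _ _ in_swap) bigU //=.
    have := X_long i iX; move: admX sizeT => /andP[].
    by rewrite /total_size (big_setD1 i iX) /=; lia.
  have := w_le _ adm_swap; rewrite /total_value (eq_bigl _ _ in_swap) bigU //=.
  have := ext_target_w_le (2 + t) (lt_trans c_gt0 cb) ba.
  have := total_rem X [set i]; rewrite sub1set iX singleton => /(_ isT).
  rewrite card_swap; move: valX valT; rewrite /total_value; lra.
have : \sum_(i in X) t%:R * c <= total_value X by apply: ler_sum.
rewrite sumr_const cardX => /le_trans/(_ (w_le _ admX)).
have := ext_target_w_le #|X| (lt_trans c_gt0 cb) ba; lra.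
Qed.

Lemma realizable_at_ge4 (K : nat) (a b c : rat) :
  realizable_at K (target_w a b) (target_r c) -> (4 <= K)%N.
Proof.
move=> /realizable_bounds[I /(_ SideR)[_ [Z [/andP[_ /=]]]]].
by move=> + cardZ; rewrite cardZ.
Qed.

(** * The exchange conditions at cap 4 *)

(** The totals of pairs force every member of the [3]-element set to have value
    at least [b > c], hence to be long. So no pair belongs to the family and the
    overlap is empty: condition (EC5) bounds each of the three values by
    [H - 3 * c], where [H = a + 2 * b], and summing gives [H <= 3 * H - 9 * c]. *)
Lemma ECv_bound (a b c : rat) : 0 < c -> c < b -> b <= a ->
  ECv 4 (target_w a b) (target_r c) -> 9 * c / 2 <= a + 2 * b.
Proof.
move=> c_gt0 cb ba [_ _ _ [W [famW [linkW [ec1 _ ec3 _ ec5]]]]].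
have w3 : is_vertex (target_w a b) 3 by split=> //; left.
have r3 : is_vertex (target_r c) 3 by split=> //; left.
have [F0 F_down F_short] := famW 3%N w3.
have [_ short_le x_sum subset_le _] := ec1 3%N w3.
have [_ O_short _] := ec3 3%N 3%N w3 r3.
have x_ge i : b <= ecx W (n := 3) i.
  have card2 : #|[set~ i]| = 2 by rewrite cardsC1 card_ord.
  have := subset_le [set~ i]; rewrite card2 => /(_ isT).
  have -> : \sum_(j in [set~ i]) ecx W j = \sum_(j < 3 | j != i) ecx W j.
    by apply: eq_bigl => j; rewrite !inE.
  by move: x_sum; rewrite (bigD1 i) //= /ext /=; lra.
have no_short i : i \notin ecshort W 3.
  apply/negP => /short_le; rewrite /rho1 /=.
  by have := x_ge i; lra.
have O0 : ecO W 3 3 = set0.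
  by apply/setP => i; rewrite inE; apply/negP => /(subsetP O_short); apply/negP.
have x_le y : ecx W (n := 3) y + 3 * c <= a + 2 * b.
  have /cards2P[i [i' [ii' pairE]]] : #|[set~ y]| == 2.
    by rewrite cardsC1 card_ord.
  have notF : [set i; i'] \notin ecF W 3.
    apply/negP => /(F_down _ [set i]); rewrite sub1set set21 => /(_ isT).
    by rewrite F_short; apply/negP.
  have := ec5 3%N 3%N w3 r3 isT i i' ii' notF y.
  by rewrite O0 setU0 -pairE !inE eqxx /ext /=; apply.
have : \sum_(y < 3) (ecx W y + 3 * c) <= \sum_(y < 3) (a + 2 * b).
  exact: ler_sum.
rewrite big_split /= x_sum !sumr_const !card_ord /=; lra.
Qed.

Lemma set0_elim (T : finType) : {i : T | i \in set0} -> False.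
Proof. by case=> i; rewrite inE. Qed.

(** For [n = 3], (EC5) asks that no value exceed [a + 2 * b - 3 * c], and equal
    values satisfy this as soon as [9 * c / 2 <= a + 2 * b]. For
    [n = 1], the one member has to carry the value [a]. Everything is long, so
    that the families are trivial and the overlaps empty. *)
Definition balanced_witness (a b c : rat) : ec_witness :=
  @ECWitness (fun n _ => if n == 3%N then (a + 2 * b) / 3 else a)
    (fun=> set0) (fun=> [set set0]) (fun _ _ => c) (fun _ _ => set0)
    (fun n m u => False_rect 'I_m (set0_elim u)).

Lemma vertex_target_w (a b : rat) n :
  is_vertex (target_w a b) n -> n = 1%N \/ n = 3%N.
Proof.
case=> n_gt0; rewrite /last_count /=; case: n n_gt0 => [|[|[|[|n]]]] //= _ _.
- by left.
- by case=> // /eqP; case; lra.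
- by right.
Qed.

Lemma vertex_target_r (c : rat) n : is_vertex (target_r c) n -> n = 3%N.
Proof.
case=> n_gt0; rewrite /last_count /=; case: n n_gt0 => [|[|[|[|n]]]] //= _ _.
- by case=> // /eqP; case; lra.
- by case=> // /eqP; case; lra.
Qed.

Lemma ECv_balanced (a b c : rat) : 0 < c -> c < b -> b <= a ->
  9 * c / 2 <= a + 2 * b -> ECv 4 (target_w a b) (target_r c).
Proof.
move=> c_gt0 cb ba Hc; split=> //.
  by move=> [|[|[|[|k]]]] // _; rewrite /ext /=; lra.
exists (balanced_witness a b c).
split; last split; last split.
- move=> n _ /=; split; first by rewrite inE.
    by move=> S T TS; rewrite !inE => /eqP S0; rewrite -subset0 -S0.
  by move=> i; rewrite !inE; apply/eqP/setP => /(_ i); rewrite !inE eqxx.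
- by move=> n m _ _ /=; rewrite inE.
- move=> n /vertex_target_w n_vertex /=; split.
  + by move=> i; case: n_vertex => -> /=; lra.
  + by move=> i; rewrite inE.
  + by case: n_vertex => -> /=; rewrite sumr_const card_ord; lra.
  + move=> S _; rewrite sumr_const.
    have := max_card (mem S); rewrite card_ord.
    by case: n_vertex S => -> S; case: #|S| => [|[|[|[|k]]]] //= _;
      rewrite /ext /=; lra.
  + by move=> S; rewrite inE => /eqP-> _; rewrite big_set0 cards0 /ext.
- move=> m /vertex_target_r -> /=; split.
  + by move=> j; rewrite /rho1 /=; lra.
  + by rewrite sumr_const card_ord; lra.
  + move=> S; rewrite sumr_const ext_target_r; last first.
      by have := max_card (mem S); rewrite card_ord.
    by rewrite mulr_natl.
- move=> n m _ _ /=; split; first by move=> u; case: (set0_elim u).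
    exact: subxx.
  by move=> u; case: (set0_elim u).
- move=> n m /vertex_target_w n_vertex /vertex_target_r -> k /=.
  rewrite {}/k /= cards0 => count_le i _.
  rewrite big1 => [|u]; last by case: (set0_elim u).
  by case: n_vertex i count_le => -> //= i _; rewrite /ext /=; lra.
- move=> n m /vertex_target_w n_vertex /vertex_target_r -> _ /= i i' ii' _ y _.
  case: n_vertex i i' ii' y => -> /= i i' ii' y; last by rewrite /ext /=; lra.
  by case/eqP: ii'; rewrite !ord1.
Qed.

(** * A balanced instance *)

(** One solo item, three long and three short ones, in separate summands: values
    and sizes depend on the summand only, so three counts describe a set. *)
Definition balanced_item : finType := (unit + 'I_3 + 'I_3)%type.

Definition by_class (T : Type) (s l z : T) (i : balanced_item) : T :=
  match i with inl (inl _) => s | inl (inr _) => l | inr _ => z end.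

Lemma balanced_value_ge0 (a b c : rat) (c_gt0 : 0 < c) (cb : c < b)
    (ba : b <= a) i :
  0 <= by_class a ((a + 2 * b) / 3) c i.
Proof. by case: i => [[[]|i]|i] /=; lra. Qed.

Lemma balanced_size_gt0 i : (0 < by_class 12 4 1 i)%N.
Proof. by case: i => [[]|]. Qed.

Lemma balanced_size_le i : (by_class 12 4 1 i <= 12)%N.
Proof. by case: i => [[]|]. Qed.

(** The solo item, of value [a], fills the knapsack; it serves only to raise the
    hull to [a] at count [1]. The long items, of value [(a + 2 * b) / 3], fill the
    knapsack together but do not fit into [capR = 3]; the short ones are worth
    [c] and fill [capR] together. A long item makes room for all the short ones:
    the binding trades are those of one long item for two or three short ones. *)
Definition balanced (a b c : rat) (c_gt0 : 0 < c) (cb : c < b) (ba : b <= a) :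
    instance :=
  @Instance balanced_item _ _ 3 12 (balanced_value_ge0 c_gt0 cb ba)
    balanced_size_gt0 isT balanced_size_le.

Definition solos (S : {set balanced_item}) : nat := #|(inl \o inl) @^-1: S|.
Definition longs (S : {set balanced_item}) : nat := #|(inl \o inr) @^-1: S|.
Definition shorts (S : {set balanced_item}) : nat := #|inr @^-1: S|.

Lemma sum_by_class (V : nmodType) (s l z : V) (S : {set balanced_item}) :
  \sum_(i in S) by_class s l z i = s *+ solos S + l *+ longs S + z *+ shorts S.
Proof.
rewrite !big_sumType /= -!sumr_const; congr (_ + _ + _);
  by apply: eq_bigl => i; rewrite inE.
Qed.

Lemma counts_le (S : {set balanced_item}) :
  [/\ (solos S <= 1)%N, (longs S <= 3)%N & (shorts S <= 3)%N].
Proof.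
split; [have := max_card (mem ((inl \o inl) @^-1: S : {set unit}))
    | have := max_card (mem ((inl \o inr) @^-1: S : {set 'I_3}))
    | have := max_card (mem (inr @^-1: S : {set 'I_3}))];
  by rewrite ?card_unit ?card_ord.
Qed.

Lemma card_by_counts (S : {set balanced_item}) :
  #|S| = (solos S + longs S + shorts S)%N.
Proof.
rewrite -sum1_card (eq_bigr (by_class 1%N 1%N 1%N)) => [|[[]|] //].
by rewrite (sum_by_class (V := nat)) !natn.
Qed.

Lemma size_by_counts (a b c : rat) (c_gt0 : 0 < c) (cb : c < b) (ba : b <= a)
    (S : {set item (balanced c_gt0 cb ba)}) :
  total_size S = (solos S * 12 + longs S * 4 + shorts S)%N.
Proof.
have natmulE m n : (m : nat) *+ n = (n * m)%N by rewrite -mulr_natl natn.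
by rewrite /total_size (sum_by_class (V := nat)) !natmulE muln1.
Qed.

Lemma value_by_counts (a b c : rat) (c_gt0 : 0 < c) (cb : c < b) (ba : b <= a)
    (S : {set item (balanced c_gt0 cb ba)}) :
  total_value S =
    (solos S)%:R * a + (longs S)%:R * ((a + 2 * b) / 3) + (shorts S)%:R * c.
Proof. by rewrite /total_value sum_by_class !mulr_natl. Qed.

(** The two hypotheses on [a + 2 * b] are the trades of one long item for two
    short ones (four items in all) and for three short ones (five, too many at
    cap [4]). *)
Lemma balanced_value_le cap (a b c : rat) (c_gt0 : 0 < c) (cb : c < b)
    (ba : b <= a) (S : {set item (balanced c_gt0 cb ba)}) al :
    6 * c <= a + 2 * b ->
    (9 * c <= a + 2 * b \/ cap = Some 4%N) ->
    admissible cap al S ->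
  total_value S <=
    ext (match al with SideW => target_w a b | SideR => target_r c end) #|S|.
Proof.
move=> H6 H9 /andP[].
rewrite size_by_counts value_by_counts (card_by_counts S).
have [] := counts_le S.
move: (solos S) (longs S) (shorts S) => p q r p1 q3 r3.
have count4 : count_ok cap al (p + q + r) ->
    9 * c <= a + 2 * b \/ (p + q + r <= 4)%N.
  by case: H9 => [|->]; [left | case: al => /=; right; lia].
case: al count4 => /= count4 size_le /count4 {count4 H9}; last first.
  have [-> ->] : p = 0%N /\ q = 0%N by lia.
  move=> _; rewrite add0n ext_target_r //; lra.
case: p p1 size_le => [|[|p]] //= _ size_le; last first.
  by have [-> ->] : q = 0%N /\ r = 0%N by [lia]; rewrite /ext /= => _; lra.
move: q r q3 r3 size_le.
by move=> [|[|[|[|q]]]] [|[|[|[|r]]]] => // _ _ _ [?|?] //; rewrite /ext /=; lra.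
Qed.

Definition class_set (s l z : bool) : {set balanced_item} :=
  [set i | by_class s l z i].

Lemma class_set_counts (s l z : bool) :
  [/\ solos (class_set s l z) = s, longs (class_set s l z) = (l * 3)%N &
      shorts (class_set s l z) = (z * 3)%N].
Proof.
have card_cst (T : finType) (x : bool) (A : {set T}) :
  A =i (fun=> x) -> #|A| = (x * #|T|)%N.
  by move=> /eq_card->; case: x; rewrite ?mul1n // mul0n; apply: eq_card0.
split; rewrite /solos /longs /shorts.
- by rewrite (@card_cst _ s) ?card_unit ?muln1 // => i; rewrite !inE.
- by rewrite (@card_cst _ l) ?card_ord // => i; rewrite !inE.
- by rewrite (@card_cst _ z) ?card_ord // => i; rewrite !inE.
Qed.

Lemma balanced_realizes cap (a b c : rat) :
    0 < c -> c < b -> b <= a ->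
    6 * c <= a + 2 * b ->
    (9 * c <= a + 2 * b /\ count_ok cap SideW 4) \/ cap = Some 4%N ->
  realizable cap (target_w a b) (target_r c).
Proof.
move=> c_gt0 cb ba H6 Hcap.
have count4 : count_ok cap SideW 4 by case: Hcap => [[]|->].
have H9 : 9 * c <= a + 2 * b \/ cap = Some 4%N by case: Hcap => [[]|]; auto.
pose I := balanced c_gt0 cb ba.
pose target al := match al with SideW => target_w a b | SideR => target_r c end.
have value_le al (S : {set item I}) :
    admissible cap al S -> total_value S <= ext (target al) #|S|.
  exact: balanced_value_le.
have U_at al (s l z : bool) :
    (s * 12 + l * 3 * 4 + z * 3 <= capacity I al)%N ->
    (s + l * 3 + z * 3 <= 3)%N ->
    (target al)`_(s + l * 3 + z * 3) <=
      s%:R * a + (l * 3)%:R * ((a + 2 * b) / 3) + (z * 3)%:R * c ->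
  U I cap al (s + l * 3 + z * 3) = ((target al)`_(s + l * 3 + z * 3))%:E.
  move=> size_ok n_le val_ge; have [ns nl nz] := class_set_counts s l z.
  have cardS : #|class_set s l z| = (s + l * 3 + z * 3)%N.
    by rewrite card_by_counts ns nl nz.
  rewrite -cardS; apply: (U_of_attained (value_le al)); rewrite ?cardS.
  - by case: (al).
  - rewrite /admissible size_by_counts ns nl nz size_ok cardS.
    by case: (cap) (al) count4 => [K|] // [] /=; lia.
  - by rewrite value_by_counts ns nl nz.
have U0 al : U I cap al 0 = ((target al)`_0)%:E.
  by apply: (U_at al false false false) => //; case: (al) => /=; lra.
have Uw1 : U I cap SideW 1 = a%:E.
  by apply: (U_at SideW true false false) => //=; lra.
have Uw3 : U I cap SideW 3 = (a + 2 * b)%:E.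
  by apply: (U_at SideW false true false) => //=; lra.
have Ur3 : U I cap SideR 3 = (3 * c)%:E.
  by apply: (U_at SideR false false true) => //=; lra.
have U_le_ext al n : (U I cap al n <= (ext (target al) n)%:E)%E.
  by apply: U_le => S admS <-; exact: value_le.
exists I => al; rewrite -/(target al); split.
  apply: terminal_count_of_increasing => //; first by case: (al).
  by case: (al) => -[|[|[|n]]] //= _; lra.
apply: hull_of_chords => //.
- by case: (al).
- by move=> n n_le; have := U_le_ext al n; rewrite /ext (minn_idPl n_le).
- move=> k k_le.
  exists (if al is SideR then c else if k == 0%N then a else b) => n.
  by case: al k k_le => -[|[|[|[|k]]]] // _; case: n => [|[|[|[|n]]]] //= _; lra.
(* Two long items may be worth less than a + b: at count 2 the SideW-hull is
   only reached by the chord from 1 to 3. *)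
move=> k k_le; case: al k_le => k_le; last first.
  exists 0%N, 3%N; split; rewrite ?U0 ?Ur3 //; first by rewrite k_le.
  by case: k k_le => [|[|[|[|k]]]] //= _; lra.
case: k k_le => [|k] k_le.
  by exists 0%N, 1%N; split; rewrite ?U0 ?Uw1 //=; lra.
exists 1%N, 3%N; split; rewrite ?Uw1 ?Uw3 //; first by rewrite k_le.
by case: k k_le => [|[|[|k]]] //= _; lra.
Qed.

(** * The four cases *)

Lemma exactly_one_nth (Ps : seq Prop) (i : nat) :
    (i < size Ps)%N -> nth False Ps i ->
    (forall j, (j < size Ps)%N -> j != i -> ~ nth False Ps j) ->
  exactly_one Ps.
Proof.
move=> i_lt Pi only_i; exists (Ordinal i_lt); split=> // j Pj; apply/val_inj/eqP.
by rewrite eq_sym; apply: contraPT Pj; apply: only_i; exact: ltn_ord.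
Qed.

Theorem theorem5p7 (a b c : rat) (hab : b <= a) (hbc : c < b) (hc : 0 < c) :
  let H := a + 2 * b in
  let Hw := [:: 0; a; a + b; H] in
  let Hr := [:: 0; c; 2 * c; 3 * c] in
  is_target_pair Hw Hr /\
  3 * c < H /\
  exactly_one [::
    (3 * c < H /\ H < 9 * c / 2) /\
      ~ ECv 4 Hw Hr /\
      (forall K : nat, (1 <= K)%N -> ~ realizable_at K Hw Hr) /\
      ~ realizable_uncapped Hw Hr;
    (9 * c / 2 <= H /\ H < 6 * c) /\
      ECv 4 Hw Hr /\
      (forall K : nat, (1 <= K)%N -> ~ realizable_at K Hw Hr) /\
      ~ realizable_uncapped Hw Hr;
    (6 * c <= H /\ H < 9 * c) /\
      (forall K : nat, (1 <= K)%N -> (realizable_at K Hw Hr <-> K = 4%N)) /\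
      ~ realizable_uncapped Hw Hr;
    9 * c <= H /\
      realizable_uncapped Hw Hr /\
      (forall K : nat, (4 <= K)%N -> realizable_at K Hw Hr)].
Proof.
move=> H Hw Hr.
have HE : H = a + 2 * b by [].
have uncapped9 : realizable_uncapped Hw Hr -> 9 * c <= H.
  by move=> /realizable_exchange-/(_ 3%N hc hbc hab isT isT); rewrite HE; lra.
have capped6 K : realizable_at K Hw Hr -> 6 * c <= H.
  move=> realK; have K4 := realizable_at_ge4 realK.
  have := realizable_exchange (t := 2) hc hbc hab realK isT K4.
  by rewrite HE; lra.
have capped9 K : (4 < K)%N -> realizable_at K Hw Hr -> 9 * c <= H.
  move=> K5 /realizable_exchange-/(_ 3%N hc hbc hab isT K5).
  by rewrite HE; lra.
have realize9 cap : 9 * c <= H -> count_ok cap SideW 4 -> realizable cap Hw Hr.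
  rewrite HE => H9 count4; apply: balanced_realizes => //; last by left.
  by lra.
have realize6 : 6 * c <= H -> realizable_at 4 Hw Hr.
  by move=> H6; apply: balanced_realizes => //; right.
split.
  by split; split=> // -[|[|[|k]]] //=; rewrite ?HE; lra.
split; first by rewrite HE; lra.
have [H9|H9] : 9 * c <= H \/ H < 9 * c by case: lerP; [left|right].
  apply: (@exactly_one_nth _ 3) => //=.
    split=> //; split; first exact: realize9.
    by move=> K K4; apply: realize9.
  by move=> [|[|[|[|[|j]]]]] //= _ _ [[_ +] _]; lra.
have not_uncapped : ~ realizable_uncapped Hw Hr by move/uncapped9; lra.
have [H6|H6] : 6 * c <= H \/ H < 6 * c by case: lerP; [left|right].
  apply: (@exactly_one_nth _ 2) => //=.
    split=> //; split=> // K _; split=> [realK|->]; last exact: realize6.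
    have K4 := realizable_at_ge4 realK.
    apply/eqP; rewrite eqn_leq K4 andbT leqNgt; apply/negP.
    by move=> /capped9/(_ realK); lra.
  by move=> [|[|[|[|[|j]]]]] //= _ _;
    [case=> -[_ +] _|case=> -[_ +] _|case=> + _]; lra.
have not_capped K : (1 <= K)%N -> ~ realizable_at K Hw Hr.
  by move=> _ /capped6; lra.
have [Hec|Hec] : 9 * c / 2 <= H \/ H < 9 * c / 2 by case: lerP; [left|right].
  apply: (@exactly_one_nth _ 1) => //=.
    by split=> //; split=> //; apply: ECv_balanced.
  by move=> [|[|[|[|[|j]]]]] //= _ _;
    [case=> -[_ +] _|case=> -[+ _] _|case=> + _]; lra.
apply: (@exactly_one_nth _ 0) => //=.
  split; first by split=> //; rewrite HE; lra.
  by split=> // /(ECv_bound hc hbc hab); rewrite -HE; lra.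
by move=> [|[|[|[|[|j]]]]] //= _ _;
  [case=> -[+ _] _|case=> -[+ _] _|case=> + _]; lra.
Qed.
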